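(* The class of functions $f:\mathbb{N}\to\mathbb{N}$ that can be computed in polynomial time by an $\mathrm{ASRAM}[+,\dot{-},\times,\div]$ is strictly larger than the class of functions that can be computed in polynomial time by an $\mathrm{ARAM}[+,\dot{-},\times,\div]$.
   Context: A $\mathrm{RAM}[\mathit{op}]$ is a unit-cost random access machine with registers $R[0],R[1],\dots$ holding nonnegative integers, with direct and indirect addressing, conditional jumps, an equality comparator, and the operations in the set $\mathit{op}$, each executed in one unit of time. On input $\mathit{inp}$ (a nonnegative integer, or a fixed number of them) the input is placed in $R[0]$, all other registers are $0$, and the output is the value of $R[0]$ at termination. Here $a\dot{-}b=\max(a-b,0)$ and $\div$ is integer division (quotient rounded down). ARAM: an $\mathrm{ARAM}[\mathit{op}]$ is given by a $\mathrm{RAM}[\mathit{op}]$ program $r$ computing a two-argument function $\rho(\mathit{inp},A)$; it computes $\rho_A$ if for every $\mathit{inp}$, $\rho(\mathit{inp},A)=\rho_A(\mathit{inp})$ for all but finitely many $A$. Its running time on $\mathit{inp}$ is the supremum over all $A$ of the running time of $r$ on $(\mathit{inp},A)$. ALS set: a nonempty set $\mathbf{S}$ of infinite integer sequences such that for every $i$ and every $\{A_k\}\in\mathbf{S}$ there is $\{B_k\}\in\mathbf{S}$ with $B_i=A_i+1$ and $B_j=A_j$ for all $j<i$. ASRAM: an $\mathrm{ASRAM}[\mathit{op}]$ is a $\mathrm{RAM}[\mathit{op}]$ program that may additionally call a pseudofunction $\mathit{ALN}()$ returning an integer. It computes $f$ if for each $\mathit{inp}$ there is an ALS set $\mathbf{S}$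 such that for every $\{A_i\}\in\mathbf{S}$, replacing the $i$-th invocation of $\mathit{ALN}()$ by the constant $A_i$ yields a RAM computing $f(\mathit{inp})$ on input $\mathit{inp}$. Its running time on $\mathit{inp}$ is the worst case over all choices of the sequence $\{A_i\}$ of the running time of the resulting RAM. Polynomial time means running time bounded by a polynomial in the bit-length of the input. *)

(* Defs.v *)
From Stdlib Require Import Arith List.
Import ListNotations.

Inductive arith_op := OAdd | OMonus | OMul | ODiv.

Definition eval_op (o : arith_op) (x y : nat) : nat :=
  match o with
  | OAdd => x + y
  | OMonus => x - y
  | OMul => x * y
  | ODiv => Nat.div x y      (* floor division; x div 0 = 0 by convention *)
  end.

Inductive instr :=
  | IConst (i c : nat)
  | IMov (i j : nat)
  | IOp (o : arith_op) (i j k : nat)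
  | ILoad (i j : nat)
  | IStore (i j : nat)
  | IJeq (i j l : nat)
  | IHalt
  | IAln (i : nat).

Definition program := list instr.

Record config := Config { cpc : nat; cregs : nat -> nat; ccnt : nat }.

Definition upd (R : nat -> nat) (i v : nat) : nat -> nat :=
  fun x => if Nat.eqb x i then v else R x.

(* One step; [a] supplies the values of the successive ALN() calls
   ([ccnt] counts the invocations made so far). *)
Definition step (p : program) (a : nat -> nat) (c : config) : config :=
  let '(Config pc R n) := c in
  match nth_error p pc with
  | None => c
  | Some IHalt => c
  | Some (IConst i v) => Config (S pc) (upd R i v) n
  | Some (IMov i j) => Config (S pc) (upd R i (R j)) n
  | Some (IOp o i j k) => Config (S pc) (upd R i (eval_op o (R j) (R k))) n
  | Some (ILoad i j) => Config (S pc) (upd R i (R (R j))) n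
  | Some (IStore i j) => Config (S pc) (upd R (R i) (R j)) n
  | Some (IJeq i j l) => Config (if Nat.eqb (R i) (R j) then l else S pc) R n
  | Some (IAln i) => Config (S pc) (upd R i (a n)) (S n)
  end.

Definition halted (p : program) (c : config) : Prop :=
  match nth_error p (cpc c) with
  | None => True
  | Some IHalt => True
  | Some _ => False
  end.

Definition run (p : program) (a : nat -> nat) (n : nat) (c : config) : config :=
  Nat.iter n (step p a) c.

Definition halts_within (p : program) (a : nat -> nat) (c : config) (t : nat) : Prop :=
  exists n, n <= t /\ halted p (run p a n c).

Definition outputs (p : program) (a : nat -> nat) (c : config) (v : nat) : Prop :=
  exists n, halted p (run p a n c) /\ cregs (run p a n c) 0 = v.

Definition no_aln (p : program) : Prop :=
  forall i, ~ In (IAln i) p.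

Definition init1 (inp : nat) : config :=
  Config 0 (fun r => if Nat.eqb r 0 then inp else 0) 0.
Definition init2 (inp A : nat) : config :=
  Config 0 (fun r => if Nat.eqb r 0 then inp else if Nat.eqb r 1 then A else 0) 0.

Definition bitlen (n : nat) : nat := match n with 0 => 1 | _ => Nat.log2 n + 1 end.
Definition polybound (c k n : nat) : nat := c * bitlen n ^ k + c.

Definition no_alns : nat -> nat := fun _ => 0.

Definition ARAM_poly (f : nat -> nat) : Prop :=
  exists (p : program) (c k : nat),
    no_aln p /\
    forall inp,
      (forall A, halts_within p no_alns (init2 inp A) (polybound c k inp)) /\
      (exists N, forall A, N <= A -> outputs p no_alns (init2 inp A) (f inp)).

Definition ALS (S : (nat -> nat) -> Prop) : Prop :=
  (exists a, S a) /\
  forall (i : nat) (a : nat -> nat), S a ->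
    exists b, S b /\ b i = a i + 1 /\ forall j, j < i -> b j = a j.

Definition ASRAM_poly (f : nat -> nat) : Prop :=
  exists (p : program) (c k : nat),
    (forall inp (a : nat -> nat), halts_within p a (init1 inp) (polybound c k inp)) /\
    forall inp, exists S : (nat -> nat) -> Prop,
      ALS S /\ forall a, S a -> outputs p a (init1 inp) (f inp).

(* Main.v *)
(* The separating function is [2 ^ 2 ^ 2 ^ t] with [t] the bit length of the input.

   An ASRAM computes it from numbers [2 = A_0 << A_1 << ... << A_t]: for [B] large
   with respect to [X] and [D], the number [X ^ D] is the remainder modulo [B] of
   [B ^ (D + 1) / (B - X)], a truncated geometric series.  So [A_(i+1) ^ D] gives
   [A_i ^ (D * D)] in boundedly many steps, and the exponent is squared [t] times.

   In an ARAM with a single number [A], restrict to large [A] divisible by a large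
   integer.  Then after [t] steps every register holds the value at [A] of a
   polynomial with rational coefficients, of degree below [2 ^ (t + 1)] and of
   height at most [h ^ 2 ^ ((t + 3) ^ 2)], because a polynomial division raises the
   height at most to a power proportional to the degree.  An output independent of
   [A] is a constant polynomial, hence bounded by the height. *)

From Stdlib Require Import Bool Arith List ZArith Lia.
Require Import Defs.
Import ListNotations.

Open Scope nat_scope.

(** * From one arbitrary number to a sequence *)

Lemma run_S p a n c : run p a (S n) c = run p a n (step p a c).
Proof. apply Nat.iter_succ_r. Qed.

Lemma run_add p a n m c : run p a (n + m) c = run p a m (run p a n c).
Proof. unfold run; rewrite Nat.add_comm; apply Nat.iter_add. Qed.

Lemma step_halted p a c : halted p c -> step p a c = c.
Proof.
  destruct c as [pc R n]; unfold halted; simpl.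
  destruct (nth_error p pc) as [[]|]; tauto.
Qed.

Lemma run_halted p a n c : halted p c -> run p a n c = c.
Proof.
  intros H; induction n as [|n IH]; [reflexivity|].
  change (run p a (S n) c) with (step p a (run p a n c)).
  now rewrite IH, step_halted.
Qed.

Lemma outputs_halts_within p a c t v :
  halts_within p a c t -> outputs p a c v -> cregs (run p a t c) 0 = v.
Proof.
  intros (n & Hn & H) (m & Hm & Hv).
  replace t with (n + (t - n)) by lia.
  rewrite run_add, run_halted by assumption.
  rewrite <- Hv; destruct (Nat.le_ge_cases n m) as [L|L].
  - replace m with (n + (m - n)) by lia; now rewrite run_add, (run_halted _ _ (m - n)).
  - replace n with (m + (n - m)) by lia; now rewrite run_add, (run_halted _ _ (n - m)).
Qed.

(** One instruction is put in front, so every jump target moves by one. *)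
Definition shift_instr (ins : instr) : instr :=
  match ins with
  | IJeq i j l => IJeq i j (S l)
  | _ => ins
  end.

Definition draw_then (p : program) : program := IAln 1 :: map shift_instr p.

(** The counter [ccnt] is left out: it differs by the extra draw, and a program without [IAln] never
    reads it. *)
Definition same_state (c c' : config) : Prop :=
  cpc c' = S (cpc c) /\ forall r, cregs c' r = cregs c r.

Lemma step_draw_then p a b c c' :
  no_aln p -> same_state c c' -> same_state (step p a c) (step (draw_then p) b c').
Proof.
  destruct c as [pc R n], c' as [pc' R' n']; intros Hp [H HR]; simpl in H, HR; subst pc'.
  unfold step; simpl nth_error; rewrite nth_error_map.
  destruct (nth_error p pc) as [[]|] eqn:E; simpl; split; simpl; unfold upd;
    try intros r; rewrite ?HR; auto.
  all: first [now destruct (_ =? _) | exfalso; eapply Hp, nth_error_In, E].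
Qed.

Lemma run_draw_then p a b n c c' :
  no_aln p -> same_state c c' -> same_state (run p a n c) (run (draw_then p) b n c').
Proof. intros Hp H; induction n as [|n IH]; [assumption|]; now apply step_draw_then. Qed.

Lemma halted_draw_then p c c' : same_state c c' -> halted p c -> halted (draw_then p) c'.
Proof.
  intros [H _]; unfold halted; rewrite H; simpl; rewrite nth_error_map.
  now destruct (nth_error p (cpc c)) as [[]|].
Qed.

Lemma run_draw_then_init p a inp n :
  no_aln p ->
  same_state (run p no_alns n (init2 inp (a 0))) (run (draw_then p) a (S n) (init1 inp)).
Proof.
  intros Hp; unfold run at 2; rewrite Nat.iter_succ_r.
  apply run_draw_then; [assumption|].
  split; [reflexivity|]; intros [|[|r]]; reflexivity.
Qed.

Lemma ARAM_poly_ASRAM_poly f : ARAM_poly f -> ASRAM_poly f.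
Proof.
  intros (p & c & k & Hp & H).
  exists (draw_then p), (S c), k; split.
  - intros inp a; destruct (H inp) as [Ht _]; destruct (Ht (a 0)) as (n & Hn & Hh).
    exists (S n); split; [unfold polybound in *; lia|].
    eapply halted_draw_then, Hh; now apply run_draw_then_init.
  - intros inp; destruct (H inp) as [_ [N HN]].
    (* Only the first number is drawn, so the ALS set just bounds it from below. *)
    exists (fun a => N <= a 0); split.
    + split; [now exists (fun _ => N)|].
      intros i a Ha; exists (upd a i (a i + 1)); unfold upd; repeat split.
      * destruct (Nat.eqb_spec 0 i); subst; lia.
      * now rewrite Nat.eqb_refl.
      * intros j Hj; destruct (Nat.eqb_spec j i); [lia|reflexivity].
    + intros a Ha; destruct (HN _ Ha) as (n & Hh & Ho).
      pose proof (run_draw_then_init p a inp n Hp) as Hs.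
      exists (S n); split; [exact (halted_draw_then _ _ _ Hs Hh)|].
      now rewrite (proj2 Hs).
Qed.

(** * Towers by an ASRAM *)

(** Meant for [P = B ^ D]: the exponent is carried implicitly by [P], and [q - q / B * B] is the
    remainder modulo [B] in the available operations. *)
Definition raise (P B X : nat) : nat :=
  let q := P * B / (B - X) in q - q / B * B.

(** The cofactor of [B - X] in [B ^ S D - X ^ S D] is the sum of all [X ^ (D - i) * B ^ i]; the term
    [X ^ D] is split off, the others being multiples of [B]. *)
Lemma geometric_division X B D :
  X <= B -> exists s, B ^ S D = (B - X) * (X ^ D + B * s) + X ^ S D.
Proof.
  intros HX; induction D as [|D [s IH]].
  - exists 0; simpl; lia.
  - exists (X ^ D + B * s).
    rewrite (Nat.pow_succ_r' B (S D)), IH.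
    remember (B - X) as Y eqn:EY; assert (EB : B = Y + X) by lia.
    rewrite !Nat.pow_succ_r'; rewrite EB at 1.
    clear - EB; subst B; ring.
Qed.

(** The bound on [B] does two jobs: [X ^ S D] lies below the divisor [B - X], which fixes the
    quotient, and [X ^ D] lies below [B], so reduction modulo [B] returns it intact. *)
Lemma raise_pow X B D : 1 <= X -> X ^ S D + X < B -> raise (B ^ D) B X = X ^ D.
Proof.
  intros HX HB; unfold raise.
  destruct (geometric_division X B D) as [s Hs]; [lia|].
  replace (B ^ D * B) with (B ^ S D) by (rewrite Nat.pow_succ_r'; ring).
  assert (HXD : X ^ D < B) by (rewrite Nat.pow_succ_r' in HB; nia).
  replace (B ^ S D / (B - X)) with (X ^ D + B * s)
    by (apply (Nat.div_unique _ _ _ (X ^ S D)); lia).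
  replace ((X ^ D + B * s) / B) with s
    by (apply (Nat.div_unique _ _ _ (X ^ D)); lia).
  lia.
Qed.

(* Registers: 0 input, 1 and 2 constants, 3 pointer, 4 the power [B ^ D], 5 the base
   [B], 6 the next base [X], 7 and 8 scratch, 9 zero, 10 the bottom address 20; the
   numbers [A_0 = 2, A_1, A_2, ...] are stored from address 20 on.  Lines 5-10 draw
   one number per bit of the input, lines 13-29 perform one squaring of [D]. *)
Definition tower_program : program :=
  [ IConst 1 1;
    IConst 2 2;
    IConst 3 20;
    IConst 10 20;
    IConst 20 2;
    IJeq 0 9 11;
    IOp OAdd 3 3 1;
    IAln 7;
    IStore 3 7;
    IOp ODiv 0 0 2;
    IJeq 0 0 5;
    ILoad 5 3;
    IOp OMul 4 5 5;
    IJeq 3 10 30;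
    IOp OMonus 3 3 1;
    ILoad 6 3;
    IOp OMul 7 4 5;
    IOp OMonus 8 5 6;
    IOp ODiv 7 7 8;
    IOp ODiv 8 7 5;
    IOp OMul 8 8 5;
    IOp OMonus 8 7 8;
    IOp OMul 7 4 5;
    IOp OMonus 8 5 8;
    IOp ODiv 7 7 8;
    IOp ODiv 8 7 5;
    IOp OMul 8 8 5;
    IOp OMonus 4 7 8;
    IMov 5 6;
    IJeq 0 0 13;
    IMov 0 4;
    IHalt ].

Lemma upd_same R i v : upd R i v i = v.
Proof. unfold upd; now rewrite Nat.eqb_refl. Qed.

Lemma upd_other R i v j : j <> i -> upd R i v j = R j.
Proof. intros H; unfold upd; now rewrite (proj2 (Nat.eqb_neq _ _) H). Qed.

Ltac lookup := repeat first [rewrite upd_same | rewrite upd_other by lia].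

Ltac exec :=
  rewrite run_S; cbn [step tower_program nth_error eval_op]; lookup.

(* [chain a] is the sequence [A_0 = 2, A_1, A_2, ...] of the header. *)
Definition chain (a : nat -> nat) (i : nat) : nat :=
  match i with 0 => 2 | S i => a i end.

Definition stores (a : nat -> nat) (t : nat) (R : nat -> nat) : Prop :=
  R 1 = 1 /\ R 10 = 20 /\ forall j, j <= t -> R (20 + j) = chain a j.

Lemma tower_collect a i R :
  stores a i R -> R 2 = 2 -> R 9 = 0 -> R 3 = 20 + i -> R 0 <> 0 ->
  exists R', run tower_program a 6 (Config 5 R i) = Config 5 R' (S i) /\
    stores a (S i) R' /\ R' 2 = 2 /\ R' 9 = 0 /\ R' 3 = 20 + S i /\ R' 0 = R 0 / 2.
Proof.
  intros (H1 & H10 & Hm) H2 H9 H3 H0.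
  eexists; split.
  - exec; rewrite H9, (proj2 (Nat.eqb_neq _ _) H0).
    exec; rewrite H3, H1; do 4 exec; rewrite Nat.eqb_refl; reflexivity.
  - unfold stores; lookup; rewrite ?H2; repeat split; auto; try lia.
    intros j Hj; lookup.
    destruct (Nat.eq_dec j (S i)) as [->|Hne].
    + replace (20 + S i) with (20 + i + 1) by lia; now lookup.
    + lookup; apply Hm; lia.
Qed.

(** Both calls of [raise] share register 4. If it holds [B ^ D] with [B] large enough, they turn the
    next base [X] into [X ^ D] and then into [X ^ (D * D)], the power needed for the next pass. *)
Lemma tower_raise a t i R :
  stores a t R -> S i <= t -> R 3 = 20 + S i -> R 5 = chain a (S i) ->
  exists R', run tower_program a 17 (Config 13 R t) = Config 13 R' t /\
    stores a t R' /\ R' 3 = 20 + i /\ R' 5 = chain a i /\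
    R' 4 = raise (R 4) (R 5) (raise (R 4) (R 5) (chain a i)).
Proof.
  intros (H1 & H10 & Hm) Hi H3 H5.
  assert (HX : R (20 + i) = chain a i) by (apply Hm; lia).
  eexists; split.
  - exec; rewrite H10, H3, (proj2 (Nat.eqb_neq (20 + S i) 20)) by lia.
    exec; rewrite H3, H1; replace (20 + S i - 1) with (20 + i) by lia.
    exec; rewrite HX; do 14 exec; rewrite Nat.eqb_refl; reflexivity.
  - unfold stores; lookup; repeat split; auto.
Qed.

Lemma tower_collect_all a R i :
  stores a i R -> R 2 = 2 -> R 9 = 0 -> R 3 = 20 + i ->
  exists s t R', s <= 6 * t + 1 /\ run tower_program a s (Config 5 R i) = Config 11 R' (i + t) /\
    stores a (i + t) R' /\ R' 3 = 20 + (i + t) /\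
    t = match R 0 with 0 => 0 | S _ => S (Nat.log2 (R 0)) end.
Proof.
  remember (R 0) as n eqn:En; revert R i En.
  induction n as [n IH] using lt_wf_ind; intros R i En HS H2 H9 H3.
  destruct (Nat.eq_dec n 0) as [->|Hn].
  - exists 1, 0, R; rewrite Nat.add_0_r; repeat split; auto; try apply HS.
    exec; now rewrite H9, <- En.
  - destruct (tower_collect a i R) as (R1 & HR1 & HS1 & H21 & H91 & H31 & H01); auto; [lia|].
    assert (Hlt : R1 0 < n) by (rewrite H01, <- En; apply Nat.div_lt; lia).
    destruct (IH (R1 0) Hlt R1 (S i)) as (s & t & R' & Hs & Hrun & HS' & H3' & Ht); auto.
    exists (6 + s), (S t), R'; rewrite run_add, HR1, Hrun.
    replace (i + S t) with (S i + t) by lia; repeat split; auto; try lia; try apply HS'.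
    (* Halving lowers the binary logarithm by one; 1 is treated apart because its half is 0. *)
    rewrite Ht, H01, <- En; destruct n as [|[|n]]; [lia|reflexivity|].
    assert (Hh : 1 <= S (S n) / 2) by (apply Nat.div_le_lower_bound; lia).
    destruct (S (S n) / 2) as [|h] eqn:Eh; [lia|].
    f_equal; symmetry; apply Nat.log2_unique; [lia|].
    pose proof (Nat.log2_spec (S h) ltac:(lia)).
    pose proof (Nat.div_mod_eq (S (S n)) 2); pose proof (Nat.mod_upper_bound (S (S n)) 2).
    rewrite Eh in *; rewrite !Nat.pow_succ_r' in *; lia.
Qed.

Fixpoint tower_value (a : nat -> nat) (i P : nat) : nat :=
  match i with
  | 0 => P
  | S j => tower_value a j (raise P (chain a i) (raise P (chain a i) (chain a j)))
  end.

Lemma tower_raise_all a t i R :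
  stores a t R -> i <= t -> R 3 = 20 + i -> R 5 = chain a i ->
  exists s R', s <= 17 * i + 2 /\ run tower_program a s (Config 13 R t) = Config 31 R' t /\
    R' 0 = tower_value a i (R 4).
Proof.
  revert R; induction i as [|i IH]; intros R HS Hi H3 H5.
  - exists 2; eexists; split; [lia|split].
    + exec; rewrite H3, (proj1 (proj2 HS)), Nat.eqb_refl; exec; reflexivity.
    + now lookup.
  - destruct (tower_raise a t i R) as (R1 & HR1 & HS1 & H31 & H51 & H41); auto.
    destruct (IH R1) as (s & R' & Hs & Hrun & H0); auto; [lia|].
    exists (17 + s), R'; rewrite run_add, HR1, Hrun; repeat split; [lia|].
    now rewrite H0, H41, H5.
Qed.

(** Differs from [bitlen] only at 0, where the drawing loop makes no turn. *)
Definition bits (n : nat) : nat := match n with 0 => 0 | S _ => S (Nat.log2 n) end.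

Lemma tower_run a inp :
  let t := bits inp in
  exists s R', s <= 23 * t + 10 /\ run tower_program a s (init1 inp) = Config 31 R' t /\
    R' 0 = tower_value a t (chain a t * chain a t).
Proof.
  intros t.
  assert (H1 : exists R, run tower_program a 5 (init1 inp) = Config 5 R 0 /\
    stores a 0 R /\ R 2 = 2 /\ R 9 = 0 /\ R 3 = 20 /\ R 0 = inp).
  { eexists; split; [unfold init1; do 5 exec; reflexivity|].
    unfold stores; lookup; repeat split.
    intros j Hj; replace j with 0 by lia; now lookup. }
  destruct H1 as (R & HR & HS & H2 & H9 & H3 & H0).
  destruct (tower_collect_all a R 0) as (s1 & t' & R1 & Hs1 & HR1 & HS1 & H31 & Ht); auto.
  rewrite Nat.add_0_l in HR1, HS1, H31; rewrite H0 in Ht; change (t' = t) in Ht; subst t'.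
  assert (H4 : exists R', run tower_program a 2 (Config 11 R1 t) = Config 13 R' t /\
    stores a t R' /\ R' 3 = 20 + t /\ R' 5 = chain a t /\ R' 4 = chain a t * chain a t).
  { destruct HS1 as (A1 & A10 & Am).
    eexists; split.
    - exec; rewrite H31, Am by lia; exec; reflexivity.
    - unfold stores; lookup; repeat split; auto; intros j Hj; lookup; auto. }
  destruct H4 as (R2 & HR2 & HS2 & H32 & H52 & H42).
  destruct (tower_raise_all a t t R2) as (s3 & R3 & Hs3 & HR3 & H03); auto.
  (* The total is at most [5 + (6 * t + 1) + 2 + (17 * t + 2)], whatever numbers are drawn. *)
  exists (5 + (s1 + (2 + s3))), R3.
  rewrite !run_add, HR, HR1, HR2, HR3; repeat split; [lia|].
  now rewrite H03, H42.
Qed.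

(** * Sequences growing fast enough *)

Definition separated (M t : nat) (a : nat -> nat) : Prop :=
  forall i, i < t -> chain a i ^ M <= a i.

(** Raising entry [i] keeps the inequality that bounds it from below, and all later entries are
    chosen afresh. *)
Lemma ALS_separated M t : ALS (separated M t).
Proof.
  assert (Hext : forall (a : nat -> nat) i, exists b : nat -> nat,
    (forall j, j < i -> b j = a j) /\ forall j, i <= j -> b j = chain b j ^ M).
  { intros a i.
    (* From index [i] on, each entry is the [M]-th power of its predecessor, with 2 as the
       predecessor of entry 0. *)
    exists (fix b j := if j <? i then a j else
              match j with 0 => 2 ^ M | S j' => b j' ^ M end).
    split; intros [|j] Hj.
    - destruct i; [lia|reflexivity].
    - now rewrite (proj2 (Nat.ltb_lt _ _) Hj).
    - destruct i; [reflexivity|lia].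
    - now rewrite (proj2 (Nat.ltb_ge _ _) Hj). }
  split.
  - destruct (Hext (fun _ => 0) 0) as (b & _ & Hb).
    exists b; intros i Hi; rewrite (Hb i); lia.
  - intros i a Ha.
    destruct (Hext (upd a i (a i + 1)) (S i)) as (b & Hlt & Hge).
    assert (Hj : forall j, j < i -> b j = a j) by (intros j Hj; rewrite Hlt by lia; now lookup).
    assert (Hi : b i = a i + 1) by (rewrite Hlt by lia; now lookup).
    exists b; repeat split; auto.
    intros j Hjt; destruct (Nat.le_gt_cases (S i) j) as [L|L]; [now rewrite (Hge j)|].
    assert (Hc : chain b j = chain a j) by (destruct j; simpl; [reflexivity|apply Hj; lia]).
    rewrite Hc; specialize (Ha j Hjt).
    destruct (Nat.eq_dec j i) as [->|]; [lia|now rewrite Hj by lia].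
Qed.

(** The second call has base [X ^ D] and needs [X ^ (D * D + D) + X ^ D < B]; one more factor [X]
    absorbs the sum, whence the bound on [M]. *)
Lemma raise_twice X B D M :
  2 <= X -> 1 <= D -> D * D + D + 1 <= M -> X ^ M <= B ->
  raise (B ^ D) B (raise (B ^ D) B X) = X ^ (D * D).
Proof.
  intros HX HD HM HB.
  assert (Hpow : forall n, n <= D * D + D -> X ^ n + X ^ n <= B).
  { intros n Hn; eapply Nat.le_trans; [|exact HB].
    apply Nat.le_trans with (X ^ S n); [rewrite Nat.pow_succ_r'; nia|].
    apply Nat.pow_le_mono_r; lia. }
  assert (Hlt : forall n m, n < m -> m <= D * D + D -> X ^ m + X ^ n < B).
  { intros n m Hnm Hm; specialize (Hpow m Hm).
    assert (X ^ n < X ^ m) by (apply Nat.pow_lt_mono_r; lia); lia. }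
  rewrite (raise_pow X).
  - rewrite raise_pow; rewrite <- ?Nat.pow_mul_r; [reflexivity| |].
    + apply Nat.le_trans with (2 ^ D); [|apply Nat.pow_le_mono_l; lia].
      pose proof (Nat.pow_nonzero 2 D); lia.
    + apply Hlt; nia.
  - lia.
  - rewrite <- (Nat.pow_1_r X) at 2; apply Hlt; nia.
Qed.

(** A pass trades level [S i] and exponent [D] for level [i] and exponent [D * D], so [D ^ 2 ^ i] is
    invariant, and a bound on [M] in terms of it serves every pass. At level 0 the base is 2. *)
Lemma tower_value_separated M t a i D :
  separated M t a -> 1 <= M -> i <= t -> 1 <= D ->
  (D ^ 2 ^ i + 1) * (D ^ 2 ^ i + 1) <= M ->
  tower_value a i (chain a i ^ D) = 2 ^ (D ^ 2 ^ i).
Proof.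
  intros Ha HM.
  assert (Hge : forall j, j <= t -> 2 <= chain a j).
  { induction j as [|j IH]; intros Hj; simpl; [lia|].
    specialize (Ha j ltac:(lia)); specialize (IH ltac:(lia)).
    apply Nat.le_trans with (chain a j ^ 1); [simpl; lia|].
    eapply Nat.le_trans; [apply Nat.pow_le_mono_r|exact Ha]; lia. }
  revert D; induction i as [|i IH]; intros D Hi HD HDM.
  - simpl; now rewrite Nat.mul_1_r.
  - assert (E : D ^ 2 ^ S i = (D * D) ^ 2 ^ i)
      by (rewrite (Nat.pow_succ_r' 2 i), Nat.pow_mul_r; simpl; now rewrite Nat.mul_1_r).
    rewrite E in HDM |- *.
    assert (HDD : D * D <= (D * D) ^ 2 ^ i).
    { rewrite <- (Nat.pow_1_r (D * D)) at 1; apply Nat.pow_le_mono_r; [nia|].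
      pose proof (Nat.pow_nonzero 2 i); lia. }
    cbn [tower_value].
    rewrite (raise_twice (chain a i) (chain a (S i)) D M);
      [apply IH; nia|apply Hge; lia|lia|nia|apply Ha; lia].
Qed.

Definition tower (inp : nat) : nat := 2 ^ 2 ^ 2 ^ bits inp.

Lemma ASRAM_poly_tower : ASRAM_poly tower.
Proof.
  exists tower_program, 23, 1; split.
  - intros inp a; destruct (tower_run a inp) as (s & R & Hs & HR & _).
    exists s; split; [|now rewrite HR].
    unfold polybound; rewrite Nat.pow_1_r.
    unfold bits, bitlen in *; destruct inp; lia.
  - intros inp; set (t := bits inp).
    (* The loop starts with [D = 2], so the final exponent is [2 ^ 2 ^ t]. *)
    exists (separated ((2 ^ 2 ^ t + 1) * (2 ^ 2 ^ t + 1)) t); split; [apply ALS_separated|].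
    intros a Ha; destruct (tower_run a inp) as (s & R & Hs & HR & H0).
    exists s; rewrite HR; split; [exact I|]; simpl cregs; rewrite H0; fold t.
    replace (chain a t * chain a t) with (chain a t ^ 2) by (simpl; now rewrite Nat.mul_1_r).
    eapply tower_value_separated; eauto; lia.
Qed.

(** * Integer polynomials *)

Open Scope Z_scope.

Fixpoint peval (P : list Z) (x : Z) : Z :=
  match P with
  | [] => 0
  | c :: P' => c + x * peval P' x
  end.

Fixpoint norm (P : list Z) : Z :=
  match P with
  | [] => 0
  | c :: P' => Z.abs c + norm P'
  end.

Fixpoint padd (P Q : list Z) : list Z :=
  match P, Q with
  | [], _ => Q
  | _, [] => P
  | c :: P', d :: Q' => (c + d) :: padd P' Q'
  end.

Definition pscale (k : Z) (P : list Z) : list Z := map (Z.mul k) P.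

Fixpoint pmul (P Q : list Z) : list Z :=
  match P with
  | [] => []
  | c :: P' => padd (pscale c Q) (0 :: pmul P' Q)
  end.

Lemma norm_nonneg P : 0 <= norm P.
Proof. induction P; simpl; lia. Qed.

Lemma peval_padd P Q x : peval (padd P Q) x = peval P x + peval Q x.
Proof.
  revert Q; induction P as [|c P IH]; intros [|d Q]; simpl; try lia.
  rewrite IH; ring.
Qed.

Lemma norm_padd P Q : norm (padd P Q) <= norm P + norm Q.
Proof.
  revert Q; induction P as [|c P IH]; intros [|d Q]; simpl; try lia.
  specialize (IH Q); lia.
Qed.

Lemma length_padd P Q : length (padd P Q) = Nat.max (length P) (length Q).
Proof.
  revert Q; induction P as [|c P IH]; intros [|d Q]; simpl; try lia.
  now rewrite IH.
Qed.

Lemma peval_pscale k P x : peval (pscale k P) x = k * peval P x.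
Proof. induction P as [|c P IH]; simpl; [|rewrite IH]; ring. Qed.

Lemma norm_pscale k P : norm (pscale k P) = Z.abs k * norm P.
Proof.
  induction P as [|c P IH]; simpl; [|rewrite IH, Z.abs_mul]; ring.
Qed.

Lemma length_pscale k P : length (pscale k P) = length P.
Proof. apply length_map. Qed.

Lemma peval_pmul P Q x : peval (pmul P Q) x = peval P x * peval Q x.
Proof.
  induction P as [|c P IH]; simpl; [ring|].
  rewrite peval_padd, peval_pscale; simpl; rewrite IH; ring.
Qed.

Lemma norm_pmul P Q : norm (pmul P Q) <= norm P * norm Q.
Proof.
  induction P as [|c P IH]; simpl; [lia|].
  pose proof (norm_padd (pscale c Q) (0 :: pmul P Q)) as H.
  rewrite norm_pscale in H; simpl in H; lia.
Qed.

Lemma length_pmul P Q : (length (pmul P Q) <= length P + length Q)%nat.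
Proof.
  induction P as [|c P IH]; simpl; [lia|].
  rewrite length_padd, length_pscale; simpl; lia.
Qed.

Lemma peval_app P Q x :
  peval (P ++ Q) x = peval P x + x ^ Z.of_nat (length P) * peval Q x.
Proof.
  induction P as [|c P IH]; cbn [app peval length]; [rewrite Z.pow_0_r; ring|].
  rewrite IH, Nat2Z.inj_succ, Z.pow_succ_r by lia; ring.
Qed.

Lemma norm_app P Q : norm (P ++ Q) = norm P + norm Q.
Proof. induction P as [|c P IH]; simpl; lia. Qed.

Lemma peval_last_pos P l : 0 < l ->
  exists N, forall x, N <= x -> 0 < peval (P ++ [l]) x.
Proof.
  intros Hl; induction P as [|c P [N IH]]; simpl.
  - exists 0; intros; lia.
  (* By integrality a positive tail is at least 1, so [x] times it exceeds [Z.abs c]. *)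
  - exists (Z.max N (Z.abs c + 1)); intros x Hx.
    specialize (IH x ltac:(lia)); nia.
Qed.

(** Isolates a nonzero leading coefficient, which decides the sign for large arguments and is the
    multiplier in pseudo-division. *)
Lemma strip_zeros P :
  (forall x, peval P x = 0) \/
  exists V l, l <> 0 /\ (forall x, peval P x = peval (V ++ [l]) x) /\
    norm (V ++ [l]) <= norm P /\ (length V < length P)%nat.
Proof.
  induction P as [|c P [IH|(V & l & Hl & E & Hn & HL)]]; simpl.
  - now left.
  - destruct (Z.eq_dec c 0) as [->|Hc].
    + left; intros x; rewrite IH; ring.
    + right; exists [], c; repeat split; simpl; try lia.
      * intros x; rewrite IH; ring.
      * pose proof (norm_nonneg P); lia.
  - right; exists (c :: V), l; repeat split; simpl; try lia.
    intros x; now rewrite E.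
Qed.

Lemma peval_trichotomy P :
  (forall x, peval P x = 0) \/
  (exists N, forall x, N <= x -> 0 < peval P x) \/
  (exists N, forall x, N <= x -> peval P x < 0).
Proof.
  destruct (strip_zeros P) as [H|(V & l & Hl & E & _)]; [now left|right].
  destruct (Z_lt_le_dec 0 l) as [Hp|Hp].
  - left; destruct (peval_last_pos V l Hp) as [N HN].
    exists N; intros x Hx; rewrite E; auto.
  - right; destruct (peval_last_pos (pscale (-1) V) (-l) ltac:(lia)) as [N HN].
    exists N; intros x Hx; rewrite E; specialize (HN x Hx).
    rewrite peval_app, peval_pscale, length_pscale in HN.
    rewrite peval_app; cbn [peval] in *.
    replace (-1 * peval V x + _) with
      (- (peval V x + x ^ Z.of_nat (length V) * (l + x * 0))) in HN by ring; lia.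
Qed.

Lemma snoc_inv {T} (x : T) l : exists l' y, x :: l = l' ++ [y] /\ length l' = length l.
Proof.
  revert x; induction l as [|z l IH]; intros x.
  - now exists [], x.
  - destruct (IH z) as (l' & y & E & HL); exists (x :: l'), y.
    split; [now rewrite E|simpl; lia].
Qed.

(* Horner's rule turns pseudo-division into a recursion on the dividend: each
   coefficient costs exactly one factor [l], and the submultiplicativity of the
   l1 norm keeps both quotient and remainder under control. *)
Lemma pseudo_division V l U :
  let W := V ++ [l] in
  let e := Z.of_nat (length U) in
  1 <= norm W ->
  exists Q R,
    (forall x, l ^ e * peval U x = peval Q x * peval W x + peval R x) /\
    length R = length V /\ length Q = length U /\
    norm R <= norm W ^ e * norm U /\
    norm Q <= e * norm W ^ e * norm U.
Proof.
  intros W e Hv; subst e.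
  assert (HW : norm W = norm V + Z.abs l) by (unfold W; rewrite norm_app; simpl; lia).
  induction U as [|c U (Q & R & E & HR & HQ & NR & NQ)].
  (* The zero remainder is padded, so that the recursion always carries exactly [length V]
     coefficients. *)
  - exists [], (repeat 0 (length V)); simpl length.
    assert (Hz : forall n x, peval (repeat 0 n) x = 0)
      by (induction n as [|n IH]; intros x; simpl; [|rewrite IH]; ring).
    assert (Hn : forall n, norm (repeat 0 n) = 0)
      by (induction n as [|n IH]; simpl; lia).
    repeat split; simpl; rewrite ?repeat_length, ?Hn; auto; try lia.
  - set (n := length U) in *.
    set (v := norm W) in *.
    pose proof (norm_nonneg U) as HU; pose proof (norm_nonneg V) as HV.
    destruct (snoc_inv (l ^ Z.of_nat n * c) R) as (R1 & r & ER & LR).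
    assert (Hvn : 0 < v ^ Z.of_nat n) by (apply Z.pow_pos_nonneg; lia).
    assert (Hln : Z.abs (l ^ Z.of_nat n * c) <= v ^ Z.of_nat n * Z.abs c).
    { rewrite Z.abs_mul, Z.abs_pow.
      apply Z.mul_le_mono_nonneg_r; [lia|].
      apply Z.pow_le_mono_l; lia. }
    assert (NR1 : norm R1 + Z.abs r <= v ^ Z.of_nat n * (Z.abs c + norm U)).
    { pose proof (f_equal norm ER) as H; rewrite norm_app in H; simpl in H; lia. }
    pose proof (norm_nonneg R1) as HR1.
    (* [r] is the surplus top coefficient of the shifted remainder. As [l * x ^ length V] is
       [W - V], multiplying by [l] turns its term into [r * W - r * V]. *)
    exists (r :: pscale l Q), (padd (pscale l R1) (pscale (- r) V)).
    cbn [length peval norm]; fold n.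
    rewrite Nat2Z.inj_succ, !Z.pow_succ_r by lia.
    repeat split.
    + intros x.
      pose proof (f_equal (fun S => peval S x) ER) as H.
      cbn [peval] in H; rewrite peval_app in H; cbn [peval] in H.
      rewrite peval_padd, !peval_pscale.
      unfold W in E |- *; specialize (E x); rewrite peval_app in E |- *.
      cbn [peval] in E |- *. rewrite LR, HR in H.
      set (xn := x ^ Z.of_nat (length V)) in *.
      transitivity (l * (l ^ Z.of_nat n * c + x * (l ^ Z.of_nat n * peval U x))); [ring|].
      rewrite E.
      transitivity (l * (l ^ Z.of_nat n * c + x * peval R x) +
        l * x * (peval Q x * (peval V x + xn * (l + x * 0)))); [ring|].
      rewrite H; ring.
    + rewrite length_padd, !length_pscale; lia.
    + now rewrite length_pscale, HQ.
    + eapply Z.le_trans; [apply norm_padd|].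
      rewrite !norm_pscale, Z.abs_opp. nia.
    + rewrite norm_pscale.
      assert (Z.abs l * norm Q <= v * (Z.of_nat n * v ^ Z.of_nat n * norm U))
        by (apply Z.mul_le_mono_nonneg; try lia; apply norm_nonneg).
      assert (Z.abs r <= v * (v ^ Z.of_nat n * (Z.abs c + norm U))) by nia.
      assert (0 <= v * Z.of_nat n * v ^ Z.of_nat n * Z.abs c)
        by (repeat apply Z.mul_nonneg_nonneg; lia).
      unfold Z.succ; lia.
Qed.

(** * Functions of an arbitrary large number *)

(** A proper filter on the values of [A]. Divisibility is built in because the floor of a quotient
    of polynomials depends on residues of [A]. *)
Definition eventually (phi : nat -> Prop) : Prop :=
  exists K N : nat, (0 < K)%nat /\
    forall A, Nat.divide K A -> (N <= A)%nat -> phi A.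

Lemma eventually_and phi psi :
  eventually phi -> eventually psi -> eventually (fun A => phi A /\ psi A).
Proof.
  intros (K & N & HK & H) (K' & N' & HK' & H').
  exists (K * K')%nat, (Nat.max N N'); split; [nia|].
  intros A [q ->] HN; split; [apply H|apply H']; try lia.
  - exists (q * K')%nat; ring.
  - exists (q * K)%nat; ring.
Qed.

Lemma eventually_mono (phi psi : nat -> Prop) :
  (forall A, phi A -> psi A) -> eventually phi -> eventually psi.
Proof. intros H (K & N & HK & HN); exists K, N; auto. Qed.

Lemma eventually_forall (phi : nat -> Prop) : (forall A, phi A) -> eventually phi.
Proof. intros H; exists 1%nat, 0%nat; auto. Qed.

Lemma eventually_ge (N : Z) : eventually (fun A => N <= Z.of_nat A).
Proof. exists 1%nat, (Z.to_nat N); split; [lia|]; intros; lia. Qed.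

Lemma eventually_divide (D : Z) : 0 < D -> eventually (fun A => (D | Z.of_nat A)).
Proof.
  intros HD; exists (Z.to_nat D), 0%nat; split; [lia|].
  intros A [q ->] _; exists (Z.of_nat q); rewrite Nat2Z.inj_mul; lia.
Qed.

Lemma eventually_false : ~ eventually (fun _ => False).
Proof.
  intros (K & N & HK & H); apply (H (N * K)%nat); [now exists N|nia].
Qed.

Lemma eventually_peval_trichotomy P :
  eventually (fun A => peval P (Z.of_nat A) = 0) \/
  eventually (fun A => 0 < peval P (Z.of_nat A)) \/
  eventually (fun A => peval P (Z.of_nat A) < 0).
Proof.
  destruct (peval_trichotomy P) as [H|[[N H]|[N H]]].
  - left; now apply eventually_forall.
  - right; left; apply (eventually_mono _ _ (fun A => H (Z.of_nat A))), eventually_ge.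
  - right; right; apply (eventually_mono _ _ (fun A => H (Z.of_nat A))), eventually_ge.
Qed.

(* On large and sufficiently divisible arguments, [g] is the polynomial [P / D] with
   rational coefficients. *)
Definition nice (L : nat) (H : Z) (g : nat -> nat) : Prop :=
  exists P D, 0 < D <= H /\ norm P <= H /\ (length P <= L)%nat /\
    eventually (fun A => D * Z.of_nat (g A) = peval P (Z.of_nat A)).

Lemma nice_ext L H g g' :
  eventually (fun A => g A = g' A) -> nice L H g -> nice L H g'.
Proof.
  intros E (P & D & HD & HP & HL & HE).
  exists P, D; repeat split; try tauto.
  apply (eventually_mono (fun A => g A = g' A /\ D * Z.of_nat (g A) = peval P (Z.of_nat A))).
  - intros A [<- ?]; assumption.
  - now apply eventually_and.
Qed.

Lemma nice_mono L H L' H' g : (L <= L')%nat -> H <= H' -> nice L H g -> nice L' H' g.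
Proof.
  intros HL HH (P & D & HD & HP & HLP & HE); exists P, D; repeat split; try lia; assumption.
Qed.

Lemma nice_const L H c : (1 <= L)%nat -> 1 <= H -> Z.of_nat c <= H -> nice L H (fun _ => c).
Proof.
  intros HL HH Hc; exists [Z.of_nat c], 1; repeat split; cbn [norm length]; try lia.
  apply eventually_forall; intros; cbn [peval]; lia.
Qed.

Lemma nice_id L H : (2 <= L)%nat -> 1 <= H -> nice L H (fun A => A).
Proof.
  intros HL HH; exists [0; 1], 1; repeat split; cbn [norm length]; try lia.
  apply eventually_forall; intros; cbn [peval]; lia.
Qed.

Lemma nice_eventually_const L H g c :
  nice L H g -> eventually (fun A => g A = c) -> Z.of_nat c <= H.
Proof.
  intros (P & D & HD & HP & _ & HE) Hc.
  pose proof (eventually_and _ _ HE Hc) as HF.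
  apply Z.nlt_ge; intros Hlt; apply eventually_false.
  destruct P as [|c0 P].
  - eapply eventually_mono, HF; simpl; intros A [E1 E2]; rewrite E2 in E1; nia.
  - simpl in HP; pose proof (norm_nonneg P).
    (* Beyond this bound a nonzero tail would contribute at least [A] in absolute value; so the tail
       vanishes and [D * c = c0 <= H]. *)
    pose proof (eventually_and _ _ HF (eventually_ge (D * Z.of_nat c + Z.abs c0 + 1))) as HG.
    destruct (eventually_peval_trichotomy P) as [HT|[HT|HT]];
      eapply eventually_mono, (eventually_and _ _ HG HT); simpl;
      intros A [[[E1 E2] E3] E4]; rewrite E2 in E1; nia.
Qed.

Lemma peval_diff_divide c P D x :
  (D | x) -> exists z, peval (c :: P) x = c + D * z.
Proof. intros [q ->]; exists (q * peval P (q * D)); simpl; ring. Qed.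

(** The cross-multiplied difference is a polynomial, whose sign settles. Hence jumps and address
    comparisons come out the same for all relevant [A]. *)
Lemma nice_eq_dec L H g g' :
  nice L H g -> nice L H g' ->
  eventually (fun A => g A = g' A) \/ eventually (fun A => g A <> g' A).
Proof.
  intros (P & D & HD & _ & _ & HE) (P' & D' & HD' & _ & _ & HE').
  pose proof (eventually_and _ _ HE HE') as HF.
  destruct (eventually_peval_trichotomy (padd (pscale D' P) (pscale (- D) P')))
    as [HT|[HT|HT]]; [left|right|right];
    eapply eventually_mono, (eventually_and _ _ HF HT); intros A [[E1 E2] E3];
    rewrite peval_padd, !peval_pscale, <- E1, <- E2 in E3;
    replace (D' * _ + _) with (D * D' * (Z.of_nat (g A) - Z.of_nat (g' A))) in E3 by ring;
    assert (0 < D * D') by nia; nia.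
Qed.

Lemma nice_add L H g g' :
  1 <= H -> nice L H g -> nice L H g' -> nice L (2 * H ^ 2) (fun A => g A + g' A)%nat.
Proof.
  intros HH (P & D & HD & HP & HL & HE) (P' & D' & HD' & HP' & HL' & HE').
  exists (padd (pscale D' P) (pscale D P')), (D * D'); repeat split.
  - nia.
  - nia.
  - eapply Z.le_trans; [apply norm_padd|]; rewrite !norm_pscale.
    pose proof (norm_nonneg P); pose proof (norm_nonneg P'); nia.
  - rewrite length_padd, !length_pscale; lia.
  - eapply eventually_mono, (eventually_and _ _ HE HE'); intros A [E E'].
    rewrite peval_padd, !peval_pscale, <- E, <- E', Nat2Z.inj_add; ring.
Qed.

Lemma nice_sub L H g g' :
  1 <= H -> nice L H g -> nice L H g' -> nice L (2 * H ^ 2) (fun A => g A - g' A)%nat.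
Proof.
  intros HH (P & D & HD & HP & HL & HE) (P' & D' & HD' & HP' & HL' & HE').
  pose proof (eventually_and _ _ HE HE') as HF.
  set (S := padd (pscale D' P) (pscale (- D) P')).
  assert (ES : forall x, peval S x = D' * peval P x - D * peval P' x)
    by (intros x; unfold S; rewrite peval_padd, !peval_pscale; ring).
  assert (Hpos : eventually (fun A => 0 <= peval S (Z.of_nat A)) ->
    nice L (2 * H ^ 2) (fun A => g A - g' A)%nat).
  { intros HT; exists S, (D * D'); repeat split.
    - nia.
    - nia.
    - eapply Z.le_trans; [apply norm_padd|]; rewrite !norm_pscale.
      pose proof (norm_nonneg P); pose proof (norm_nonneg P'); nia.
    - unfold S; rewrite length_padd, !length_pscale; lia.
    - eapply eventually_mono, (eventually_and _ _ HF HT); intros A [[E E'] ET].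
      rewrite ES, <- E, <- E' in ET |- *.
      replace (D' * _ - _) with (D * D' * (Z.of_nat (g A) - Z.of_nat (g' A))) in * by ring.
      assert (0 < D * D') by nia.
      rewrite Nat2Z.inj_sub by nia; ring. }
  destruct (eventually_peval_trichotomy S) as [HT|[HT|HT]].
  - apply Hpos; eapply eventually_mono, HT; simpl; intros; lia.
  - apply Hpos; eapply eventually_mono, HT; simpl; intros; lia.
  - exists [], 1; repeat split; cbn [norm length]; try nia.
    eapply eventually_mono, (eventually_and _ _ HF HT); intros A [[E E'] ET].
    rewrite ES, <- E, <- E' in ET.
    replace (D' * _ - _) with (D * D' * (Z.of_nat (g A) - Z.of_nat (g' A))) in ET by ring.
    assert (0 < D * D') by nia.
    replace (g A - g' A)%nat with 0%nat by nia; reflexivity.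
Qed.

Lemma nice_mul L H g g' :
  1 <= H -> nice L H g -> nice L H g' -> nice (2 * L) (H ^ 2) (fun A => g A * g' A)%nat.
Proof.
  intros HH (P & D & HD & HP & HL & HE) (P' & D' & HD' & HP' & HL' & HE').
  exists (pmul P P'), (D * D'); repeat split.
  - nia.
  - nia.
  - eapply Z.le_trans; [apply norm_pmul|].
    pose proof (norm_nonneg P); pose proof (norm_nonneg P'); nia.
  - pose proof (length_pmul P P'); lia.
  - eapply eventually_mono, (eventually_and _ _ HE HE'); intros A [E E'].
    rewrite peval_pmul, <- E, <- E', Nat2Z.inj_mul; ring.
Qed.

(* [floor (U / V)] when [D * U = Q * V + R], where [q] and [r] are the quotient
   and remainder of the constant coefficient of [Q] by [D]. *)
Lemma floor_of_pseudo_division D U V q r z R :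
  0 < D -> 0 < V -> D * U = (D * (q + z) + r) * V + R -> 0 <= r < D -> Z.abs R < V ->
  U / V = q + z - (if (r =? 0) && (R <? 0) then 1 else 0).
Proof.
  intros HD HV E Hr HR.
  destruct ((r =? 0) && (R <? 0)) eqn:B.
  - apply andb_prop in B as [B1 B2].
    apply Z.eqb_eq in B1; apply Z.ltb_lt in B2; subst r.
    symmetry; apply Z.div_unique_pos with (U - (q + z - 1) * V); [|ring].
    split; nia.
  - assert (Hc : 0 < r \/ (r = 0 /\ 0 <= R)).
    { destruct (Z.eqb_spec r 0), (Z.ltb_spec R 0); simpl in B; try discriminate; lia. }
    symmetry; apply Z.div_unique_pos with (U - (q + z) * V); [|ring].
    assert (D * (U - (q + z) * V) = r * V + R) by (rewrite Z.mul_sub_distr_l, E; ring).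
    split; nia.
Qed.

(** With common denominators cleared, pseudo-division gives [d * U = Q * W + R] with [d] a power of
    the leading coefficient of the divisor [W]. For [A] divisible by [d], all nonconstant terms of
    [Q] are multiples of [d], so the floor changes only the constant term. *)
Lemma nice_div L H g g' :
  (1 <= L)%nat -> 1 <= H -> nice L H g -> nice L H g' ->
  nice L ((Z.of_nat L + 2) * H ^ (2 * Z.of_nat L + 2)) (fun A => g A / g' A)%nat.
Proof.
  intros HL1 HH (P & D & HD & HP & HL & HE) (P' & D' & HD' & HP' & HL' & HE').
  assert (HHp : forall n, 0 <= n -> 0 < H ^ n) by (intros; apply Z.pow_pos_nonneg; lia).
  assert (HB : 1 <= (Z.of_nat L + 2) * H ^ (2 * Z.of_nat L + 2)).
  { specialize (HHp (2 * Z.of_nat L + 2)); nia. }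
  destruct (strip_zeros (pscale D P')) as [Hz|(V & l & Hl & EV & NV & LV)].
  (* A divisor that vanishes identically gives 0 by the convention for division by zero. *)
  { apply nice_ext with (fun _ => 0%nat).
    - eapply eventually_mono, HE'; intros A E'; simpl.
      specialize (Hz (Z.of_nat A)); rewrite peval_pscale, <- E' in Hz.
      replace (g' A) with 0%nat by nia; reflexivity.
    - apply nice_const; lia. }
  set (U := pscale D' P).
  rewrite norm_pscale in NV; rewrite length_pscale in LV.
  pose proof (norm_nonneg P) as NP; pose proof (norm_nonneg P') as NP'.
  assert (NV1 : 1 <= norm (V ++ [l])).
  { rewrite norm_app; simpl; pose proof (norm_nonneg V); lia. }
  assert (NU : norm U <= H ^ 2) by (unfold U; rewrite norm_pscale; nia).
  assert (NV2 : norm (V ++ [l]) <= H ^ 2) by nia.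
  destruct (pseudo_division V l U NV1) as (Q & R & E & LR & LQ & NR & NQ).
  set (n := length U) in *.
  assert (Hn : (n <= L)%nat) by (unfold n, U; rewrite length_pscale; lia).
  assert (Hpos : eventually (fun A => 0 <= peval (V ++ [l]) (Z.of_nat A))).
  { eapply eventually_mono, HE'; intros A E'; simpl.
    rewrite <- EV, peval_pscale, <- E'; nia. }
  assert (Hlpos : 0 < l).
  { destruct (Z_lt_le_dec 0 l) as [|Hneg]; [assumption|exfalso].
    destruct (peval_last_pos (pscale (-1) V) (- l) ltac:(lia)) as [N HN].
    apply eventually_false.
    eapply eventually_mono, (eventually_and _ _ Hpos (eventually_ge N)).
    intros A [E1 E2]; specialize (HN _ E2).
    rewrite peval_app, peval_pscale, length_pscale in HN.
    rewrite peval_app in E1; cbn [peval] in HN, E1.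
    set (y := Z.of_nat A ^ Z.of_nat (length V)) in *.
    replace (-1 * peval V (Z.of_nat A) + y * (- l + Z.of_nat A * 0)) with
      (- (peval V (Z.of_nat A) + y * (l + Z.of_nat A * 0))) in HN by ring; lia. }
  (* [R] has only [length V] coefficients, so adding or subtracting it leaves the leading
     coefficient [l] in place. *)
  assert (HRV : eventually (fun A =>
    Z.abs (peval R (Z.of_nat A)) < peval (V ++ [l]) (Z.of_nat A))).
  { assert (HS : forall k, exists N, forall x, N <= x ->
      0 < peval (V ++ [l]) x + k * peval R x).
    { intros k; destruct (peval_last_pos (padd V (pscale k R)) l Hlpos) as [N HN].
      exists N; intros x Hx; specialize (HN x Hx).
      rewrite peval_app, length_padd, length_pscale, LR, Nat.max_id, peval_padd, peval_pscale
        in HN; rewrite peval_app; lia. }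
    destruct (HS 1) as [N HN], (HS (-1)) as [N' HN'].
    eapply eventually_mono, (eventually_ge (Z.max N N')); cbv beta; intros A HA.
    specialize (HN (Z.of_nat A) ltac:(lia)); specialize (HN' (Z.of_nat A) ltac:(lia)); lia. }
  set (d := l ^ Z.of_nat n) in *.
  assert (Hd : 0 < d) by (apply Z.pow_pos_nonneg; lia).
  set (M := H ^ (2 * Z.of_nat L)).
  assert (HM : norm (V ++ [l]) ^ Z.of_nat n <= M).
  { unfold M; rewrite Z.pow_mul_r by lia.
    eapply Z.le_trans; [apply Z.pow_le_mono_l; split; [|exact NV2]; lia|].
    apply Z.pow_le_mono_r; lia. }
  assert (Hdn : d <= norm (V ++ [l]) ^ Z.of_nat n).
  { apply Z.pow_le_mono_l; rewrite norm_app; simpl; pose proof (norm_nonneg V); lia. }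
  assert (NQ' : norm Q <= Z.of_nat L * M * H ^ 2).
  { eapply Z.le_trans; [exact NQ|].
    apply Z.mul_le_mono_nonneg; [nia| |apply norm_nonneg|assumption].
    apply Z.mul_le_mono_nonneg; lia. }
  assert (Hdiv : forall A,
      D * Z.of_nat (g A) = peval P (Z.of_nat A) ->
      D' * Z.of_nat (g' A) = peval P' (Z.of_nat A) ->
      0 < peval (V ++ [l]) (Z.of_nat A) ->
      Z.of_nat (g A / g' A) = peval U (Z.of_nat A) / peval (V ++ [l]) (Z.of_nat A)).
  { intros A E1 E2 Hp; unfold U; rewrite <- EV, !peval_pscale, <- E1, <- E2 in *.
    rewrite Nat2Z.inj_div.
    replace (D' * (D * Z.of_nat (g A))) with ((D * D') * Z.of_nat (g A)) by ring.
    replace (D * (D' * Z.of_nat (g' A))) with ((D * D') * Z.of_nat (g' A)) in * by ring.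
    rewrite Z.div_mul_cancel_l; nia. }
  assert (HRs : exists b : bool, eventually (fun A => (peval R (Z.of_nat A) <? 0) = b)).
  { destruct (eventually_peval_trichotomy R) as [HT|[HT|HT]];
      [exists false|exists false|exists true]; eapply eventually_mono, HT; simpl; intros A HA.
    - rewrite HA; reflexivity.
    - apply Z.ltb_ge; lia.
    - now apply Z.ltb_lt. }
  destruct HRs as [b Hb].
  assert (HQ : exists c0 Q', (forall x, peval Q x = peval (c0 :: Q') x) /\
    norm Q = norm (c0 :: Q') /\ (length (c0 :: Q') <= L)%nat).
  { destruct Q as [|c0 Q'].
    - exists 0, []; simpl; repeat split; try lia; intros; lia.
    - exists c0, Q'; rewrite LQ; auto. }
  destruct HQ as (c0 & Q' & EQ & NQQ & LQQ).
  rewrite NQQ in NQ'; simpl in NQ'.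
  set (r := c0 mod d).
  pose proof (Z.mod_pos_bound c0 d Hd) as Hr; fold r in Hr.
  set (delta := if (r =? 0) && b then 1 else 0).
  assert (Hdelta : 0 <= delta <= 1) by (unfold delta; destruct (_ && _); lia).
  assert (EM : H ^ (2 * Z.of_nat L + 2) = M * H ^ 2) by (apply Z.pow_add_r; lia).
  assert (HH2 : 1 <= H ^ 2) by nia.
  assert (Hd2 : d <= M * H ^ 2) by nia.
  (* Subtracting [r] rounds the constant term down to a multiple of [d]; [delta] corrects for a
     negative [R] when [r = 0]. *)
  exists ((c0 - r - d * delta) :: Q'), d; rewrite EM; repeat split.
  - assumption.
  - nia.
  - simpl; nia.
  - exact LQQ.
  - eapply eventually_mono, (eventually_and _ _ (eventually_and _ _ (eventually_and _ _ HE HE')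
      (eventually_and _ _ HRV Hb)) (eventually_divide d Hd)).
    intros A [[[E1 E2] [E3 E4]] E5].
    set (x := Z.of_nat A) in *.
    rewrite (Hdiv A E1 E2) by (fold x; lia); fold x.
    destruct (peval_diff_divide c0 Q' d x E5) as [z Ez].
    rewrite (floor_of_pseudo_division d _ _ (c0 / d) r z (peval R x) Hd); try lia.
    + rewrite E4; fold delta.
      simpl in Ez |- *; pose proof (Z.div_mod c0 d ltac:(lia)) as Hdm; fold r in Hdm.
      replace (x * peval Q' x) with (d * z) by lia.
      rewrite !Z.mul_sub_distr_l, Z.mul_add_distr_l; lia.
    + rewrite E, EQ, Ez; pose proof (Z.div_mod c0 d ltac:(lia)) as Hdm; fold r in Hdm.
      rewrite Hdm at 1; ring.
Qed.

(** * Outputs of an ARAM *)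

(** Division is the costliest operation; its factor [L + 2] is absorbed by [H ^ (L + 1)]. *)
Definition op_height (L : nat) (H : Z) : Z := H ^ (3 * Z.of_nat L + 3).

Lemma le_op_height L H : 2 <= H -> H <= op_height L H.
Proof.
  intros HH; unfold op_height; rewrite <- (Z.pow_1_r H) at 1; apply Z.pow_le_mono_r; lia.
Qed.

Lemma nice_op o L H g g' :
  (1 <= L)%nat -> 2 <= H -> nice L H g -> nice L H g' ->
  nice (2 * L) (op_height L H) (fun A => eval_op o (g A) (g' A)).
Proof.
  intros HL HH Hg Hg'.
  assert (H3 : 2 * H ^ 2 <= op_height L H).
  { apply Z.le_trans with (H ^ 3); [nia|].
    apply Z.pow_le_mono_r; lia. }
  destruct o; simpl.
  - eapply nice_mono; [| |apply nice_add; eauto]; lia.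
  - eapply nice_mono; [| |apply nice_sub; eauto]; lia.
  - eapply nice_mono; [| |apply nice_mul; eauto]; lia.
  - eapply nice_mono; [| |apply nice_div; eauto]; try lia.
    unfold op_height.
    replace (3 * Z.of_nat L + 3) with ((Z.of_nat L + 1) + (2 * Z.of_nat L + 2)) by ring.
    rewrite (Z.pow_add_r H (Z.of_nat L + 1)) by lia.
    apply Z.mul_le_mono_nonneg_r; [apply Z.pow_nonneg; lia|].
    apply Z.le_trans with (2 ^ (Z.of_nat L + 1)); [|apply Z.pow_le_mono_l; lia].
    clear; induction L as [|L IH]; [reflexivity|].
    rewrite Nat2Z.inj_succ; replace (Z.succ (Z.of_nat L) + 1) with (Z.succ (Z.of_nat L + 1)) by lia.
    rewrite Z.pow_succ_r by lia; lia.
Qed.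

(* The address [g A] may depend on [A]: this is what indirect addressing needs. *)
Definition nice_memory (L : nat) (H : Z) (M : nat -> nat -> nat) : Prop :=
  forall L' H' g, (L <= L')%nat -> H <= H' -> nice L' H' g -> nice L' H' (fun A => M A (g A)).

Lemma nice_memory_upd L H L' H' M a v :
  (L <= L')%nat -> H <= H' -> nice_memory L H M -> nice L' H' a -> nice L' H' v ->
  nice_memory L' H' (fun A => upd (M A) (a A) (v A)).
Proof.
  intros HL HH HM Ha Hv L1 H1 g HL1 HH1 Hg.
  destruct (nice_eq_dec L1 H1 g a) as [E|E]; eauto using nice_mono.
  - apply nice_ext with v; [|eauto using nice_mono].
    eapply eventually_mono, E; simpl; intros A ->; now rewrite upd_same.
  - apply nice_ext with (fun A => M A (g A)); [|apply HM; auto; lia].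
    eapply eventually_mono, E; simpl; intros A HA; now rewrite upd_other.
Qed.

Lemma nice_memory_ext L H M M' :
  eventually (fun A => M A = M' A) -> nice_memory L H M -> nice_memory L H M'.
Proof.
  intros E HM L' H' g HL HH Hg; eapply nice_ext, HM; eauto.
  eapply eventually_mono, E; simpl; now intros A ->.
Qed.

(** Jump targets are left out, as they never enter a register. *)
Definition instr_size (ins : instr) : nat :=
  match ins with
  | IConst i c => i + c
  | IMov i j | ILoad i j | IStore i j => i + j
  | IOp _ i j k => i + j + k
  | IJeq i j _ => i + j
  | IHalt => 0
  | IAln i => i
  end.

Definition program_size (p : program) : nat := list_max (map instr_size p).

Lemma instr_size_le p pc ins :
  nth_error p pc = Some ins -> (instr_size ins <= program_size p)%nat.
Proof.
  intros H; apply nth_error_In in H; unfold program_size.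
  pose proof (proj1 (list_max_le (map instr_size p) _) (le_n _)) as HF.
  rewrite Forall_forall in HF; apply HF, in_map, H.
Qed.

(** One program counter serves all relevant [A]: the runs follow a common path. *)
Definition nice_configs (L : nat) (H : Z) (c : nat -> config) : Prop :=
  (exists pc, eventually (fun A => cpc (c A) = pc)) /\
  nice_memory L H (fun A => cregs (c A)).

Lemma nice_configs_step p L H c :
  (1 <= L)%nat -> 2 <= H -> Z.of_nat (program_size p) <= H ->
  nice_configs L H c ->
  nice_configs (2 * L) (op_height L H) (fun A => step p no_alns (c A)).
Proof.
  intros HL HH Hp [[pc Hpc] HM].
  pose proof (le_op_height L H HH) as Hop.
  set (L' := (2 * L)%nat) in *; set (H' := op_height L H) in *.
  assert (HL' : (L <= L')%nat) by (unfold L'; lia).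
  assert (HC : forall i, (i <= program_size p)%nat -> nice L H (fun _ => i))
    by (intros i Hi; apply nice_const; lia).
  assert (HR : forall i, (i <= program_size p)%nat -> nice L H (fun A => cregs (c A) i))
    by (intros i Hi; apply (HM L H (fun _ => i)); auto; lia).
  assert (Hup : forall g, nice L H g -> nice L' H' g) by (intros g; now apply nice_mono).
  assert (HM' : nice_memory L' H' (fun A => cregs (c A)))
    by (intros L1 H1 g HL1 HH1; apply HM; lia).
  assert (Hset : forall pc' a v,
    eventually (fun A => cpc (step p no_alns (c A)) = pc') ->
    eventually (fun A => upd (cregs (c A)) (a A) (v A) = cregs (step p no_alns (c A))) ->
    nice L' H' a -> nice L' H' v ->
    nice_configs L' H' (fun A => step p no_alns (c A))).
  { intros pc' a v Epc E Ha Hv; split; [now exists pc'|].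
    eapply nice_memory_ext; [exact E|].
    exact (nice_memory_upd L H L' H' _ a v HL' Hop HM Ha Hv). }
  assert (Hstay : forall pc',
    eventually (fun A => cpc (step p no_alns (c A)) = pc') ->
    eventually (fun A => cregs (c A) = cregs (step p no_alns (c A))) ->
    nice_configs L' H' (fun A => step p no_alns (c A))).
  { intros pc' Epc E; split; [now exists pc'|]; eapply nice_memory_ext; [exact E|exact HM']. }
  assert (Hev : forall phi : nat -> Prop, (forall A, cpc (c A) = pc -> phi A) -> eventually phi)
    by (intros phi Hphi; exact (eventually_mono _ _ Hphi Hpc)).
  destruct (nth_error p pc) as [ins|] eqn:Eins.
  2: { apply (Hstay pc); apply Hev; intros A HA; destruct (c A); simpl in *; subst;
       now rewrite Eins. }
  pose proof (instr_size_le p pc ins Eins) as Hsz.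
  destruct ins as [i v|i j|o i j k|i j|i j|i j l| |i]; simpl in Hsz.
  - apply (Hset (S pc) (fun _ => i) (fun _ => v));
      [apply Hev|apply Hev|apply Hup, HC; lia|apply Hup, HC; lia];
      intros A HA; destruct (c A); simpl in *; subst; now rewrite Eins.
  - apply (Hset (S pc) (fun _ => i) (fun A => cregs (c A) j));
      [apply Hev|apply Hev|apply Hup, HC; lia|apply Hup, HR; lia];
      intros A HA; destruct (c A); simpl in *; subst; now rewrite Eins.
  - apply (Hset (S pc) (fun _ => i) (fun A => eval_op o (cregs (c A) j) (cregs (c A) k)));
      [apply Hev|apply Hev|apply Hup, HC; lia|apply nice_op; auto; apply HR; lia];
      intros A HA; destruct (c A); simpl in *; subst; now rewrite Eins.
  - apply (Hset (S pc) (fun _ => i) (fun A => cregs (c A) (cregs (c A) j)));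
      [apply Hev|apply Hev|apply Hup, HC; lia
      |apply Hup, (HM L H (fun A => cregs (c A) j)); auto; try lia; apply HR; lia];
      intros A HA; destruct (c A); simpl in *; subst; now rewrite Eins.
  - apply (Hset (S pc) (fun A => cregs (c A) i) (fun A => cregs (c A) j));
      [apply Hev|apply Hev|apply Hup, HR; lia|apply Hup, HR; lia];
      intros A HA; destruct (c A); simpl in *; subst; now rewrite Eins.
  - destruct (nice_eq_dec L H (fun A => cregs (c A) i) (fun A => cregs (c A) j)) as [E|E];
      try (apply HR; lia).
    + apply (Hstay l); [eapply eventually_mono, (eventually_and _ _ Hpc E)|apply Hev].
      * intros A [HA HE]; destruct (c A); simpl in *; subst; rewrite Eins; simpl.
        now rewrite (proj2 (Nat.eqb_eq _ _) HE).
      * intros A HA; destruct (c A); simpl in *; subst; now rewrite Eins.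
    + apply (Hstay (S pc)); [eapply eventually_mono, (eventually_and _ _ Hpc E)|apply Hev].
      * intros A [HA HE]; destruct (c A); simpl in *; subst; rewrite Eins; simpl.
        now rewrite (proj2 (Nat.eqb_neq _ _) HE).
      * intros A HA; destruct (c A); simpl in *; subst; now rewrite Eins.
  - apply (Hstay pc); apply Hev; intros A HA; destruct (c A); simpl in *; subst;
      now rewrite Eins.
  - apply (Hset (S pc) (fun _ => i) (fun _ => 0%nat));
      [apply Hev|apply Hev|apply Hup, HC; lia|apply Hup, HC; lia];
      intros A HA; destruct (c A); simpl in *; subst; now rewrite Eins.
Qed.

Lemma nice_configs_mono L H L' H' c :
  (L <= L')%nat -> H <= H' -> nice_configs L H c -> nice_configs L' H' c.
Proof.
  intros HL HH [Hpc HM]; split; [assumption|].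
  intros L1 H1 g HL1 HH1; apply HM; lia.
Qed.

Lemma nice_configs_run p inp (h : Z) t :
  2 <= h -> Z.of_nat (program_size p) <= h -> Z.of_nat inp <= h ->
  nice_configs (2 ^ S t) (h ^ 2 ^ ((Z.of_nat t + 3) ^ 2))
    (fun A => run p no_alns t (init2 inp A)).
Proof.
  intros Hh Hp Hi.
  assert (Hle : forall e, 0 <= e -> h <= h ^ 2 ^ e).
  { intros e He; rewrite <- (Z.pow_1_r h) at 1; apply Z.pow_le_mono_r; [lia|].
    pose proof (Z.pow_pos_nonneg 2 e); lia. }
  induction t as [|t IH].
  - apply nice_configs_mono with 2%nat h; [simpl; lia|apply Hle; lia|].
    split; [exists 0%nat; now apply eventually_forall|].
    (* The initial memory is the zero memory after two writes. *)
    set (M1 := fun A : nat => upd (fun _ => 0%nat) 1 A).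
    set (M2 := fun A : nat => upd (M1 A) 0 inp).
    apply nice_memory_ext with M2.
    + apply eventually_forall; intros A; reflexivity.
    + apply nice_memory_upd with 2%nat h; try lia; [|apply nice_const; lia|apply nice_const; lia].
      apply nice_memory_upd with 2%nat h; try lia; [|apply nice_const; lia|apply nice_id; lia].
      intros L' H' g HL HH _; apply nice_const; lia.
  - set (e := (Z.of_nat t + 3) ^ 2) in *.
    assert (He : 0 <= e) by (apply Z.pow_nonneg; lia).
    specialize (Hle e He).
    eapply nice_configs_mono; [| |apply nice_configs_step; [| | |exact IH]].
    + rewrite (Nat.pow_succ_r' 2 (S t)); lia.
    + unfold op_height; rewrite <- Z.pow_mul_r by (try apply Z.pow_nonneg; lia).
      apply Z.pow_le_mono_r; [lia|].
      rewrite Nat2Z.inj_pow, !(Nat2Z.inj_succ t); change (Z.of_nat 2) with 2.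
      rewrite (Z.pow_succ_r 2 (Z.of_nat t)) by lia.
      (* A step multiplies the exponent of [h] by [3 * 2 ^ (t + 1) + 3], at most [2 ^ (t + 4)],
         while the square in the bound grows by [2 * t + 7]. *)
      replace ((Z.succ (Z.of_nat t) + 3) ^ 2) with (e + (2 * Z.of_nat t + 7)) by (unfold e; ring).
      rewrite Z.pow_add_r by lia; apply Z.mul_le_mono_nonneg_l; [apply Z.pow_nonneg; lia|].
      apply Z.le_trans with (2 ^ (Z.of_nat t + 4)); [|apply Z.pow_le_mono_r; lia].
      rewrite Z.pow_add_r by lia; change (2 ^ 4) with 16.
      assert (0 < 2 ^ Z.of_nat t) by (apply Z.pow_pos_nonneg; lia). lia.
    + apply Nat.neq_0_lt_0, Nat.pow_nonzero; lia.
    + lia.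
    + lia.
Qed.

(** The time bound is uniform in [A], so the output can be read off register 0 at the single time
    [t]. *)
Lemma ARAM_output_bound p inp t N v :
  (forall A, halts_within p no_alns (init2 inp A) t) ->
  (forall A, (N <= A)%nat -> outputs p no_alns (init2 inp A) v) ->
  (v <= (program_size p + inp + 2) ^ 2 ^ ((t + 3) ^ 2))%nat.
Proof.
  intros Ht Hv.
  destruct (nice_configs_run p inp (Z.of_nat (program_size p + inp + 2)) t) as [_ HM];
    try lia.
  assert (Hg : nice (2 ^ S t)
    (Z.of_nat (program_size p + inp + 2) ^ 2 ^ ((Z.of_nat t + 3) ^ 2))
    (fun A => cregs (run p no_alns t (init2 inp A)) 0)).
  { apply (HM _ _ (fun _ => 0%nat)); try lia.
    assert (1 <= Z.of_nat (program_size p + inp + 2) ^ 2 ^ ((Z.of_nat t + 3) ^ 2)).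
    { apply Z.lt_pred_le, Z.pow_pos_nonneg; [lia|apply Z.pow_nonneg; lia]. }
    apply nice_const; try lia.
    apply Nat.neq_0_lt_0, Nat.pow_nonzero; lia. }
  apply (nice_eventually_const _ _ _ v) in Hg.
  - rewrite Nat2Z.inj_le, !Nat2Z.inj_pow, (Nat2Z.inj_add t); exact Hg.
  - exists 1%nat, N; split; [lia|]; intros A _ HA.
    eapply outputs_halts_within; eauto.
Qed.

Open Scope nat_scope.

(** * Growth comparison and separation *)

Lemma exp_beats_monomial b j : exists n, 1 <= n /\ b * n ^ j < 2 ^ n.
Proof.
  set (r := b + 2 * j).
  (* For this [n] it suffices to compare exponents: [b + 2 * r * j <= 2 ^ r * 2 ^ r]. *)
  exists (2 ^ (2 * r)); split; [pose proof (Nat.pow_nonzero 2 (2 * r)); lia|].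
  rewrite <- Nat.pow_mul_r.
  apply Nat.lt_le_trans with (2 ^ (b + 2 * r * j)).
  - rewrite Nat.pow_add_r; apply Nat.mul_lt_mono_pos_r.
    + pose proof (Nat.pow_nonzero 2 (2 * r * j)); lia.
    + apply Nat.pow_gt_lin_r; lia.
  - apply Nat.pow_le_mono_r; [lia|].
    replace (2 * r) with (r + r) at 2 by lia; rewrite Nat.pow_add_r.
    pose proof (Nat.pow_gt_lin_r 2 r ltac:(lia)); unfold r in *; nia.
Qed.

Lemma exp_beats_polybound s c k :
  exists m, m + s + 2 + (c * S m ^ k + c + 3) ^ 2 < 2 ^ S m.
Proof.
  destruct (exp_beats_monomial (s + 2 + (2 * c + 3) ^ 2) (S (2 * k))) as (n & Hn & H).
  exists (n - 1); replace (S (n - 1)) with n by lia.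
  eapply Nat.le_lt_trans, H.
  assert (Hk : 1 <= n ^ k) by (pose proof (Nat.pow_nonzero n k); lia).
  replace (n ^ S (2 * k)) with (n * (n ^ k) ^ 2)
    by (rewrite (Nat.pow_succ_r' n (2 * k)), <- Nat.pow_mul_r, (Nat.mul_comm k); reflexivity).
  set (x := n ^ k) in *.
  assert (c * x + c + 3 <= (2 * c + 3) * x) by nia.
  assert ((c * x + c + 3) ^ 2 <= (2 * c + 3) ^ 2 * x ^ 2)
    by (rewrite <- Nat.pow_mul_l; apply Nat.pow_le_mono_l; lia).
  assert (1 <= x ^ 2) by (simpl; nia).
  set (X := x ^ 2) in *; set (Y := (2 * c + 3) ^ 2) in *.
  nia.
Qed.

Lemma not_ARAM_poly_tower : ~ ARAM_poly tower.
Proof.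
  intros (p & c & k & _ & H).
  destruct (exp_beats_polybound (program_size p) c k) as [m Hm].
  destruct (H (2 ^ m)) as [Ht [N HN]].
  pose proof (ARAM_output_bound _ _ _ _ _ Ht HN) as Hb.
  assert (Hpos : 1 <= 2 ^ m) by (pose proof (Nat.pow_nonzero 2 m); lia).
  assert (Hbits : bits (2 ^ m) = S m).
  { unfold bits; destruct (2 ^ m) eqn:E; [lia|]; rewrite <- E, Nat.log2_pow2; lia. }
  assert (Hlen : bitlen (2 ^ m) = S m).
  { unfold bitlen; destruct (2 ^ m) eqn:E; [lia|]; rewrite <- E, Nat.log2_pow2; lia. }
  unfold tower, polybound in Hb; rewrite Hbits, Hlen in Hb.
  set (e := (c * S m ^ k + c + 3) ^ 2) in *.
  set (s := program_size p) in *.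
  (* With base 2 on both sides, the claim contradicted is [2 ^ 2 ^ S m <= (m + s + 2) * 2 ^ e],
     where [m + s + 2 + e < 2 ^ S m] by the choice of [m]. *)
  assert (Hbase : s + 2 ^ m + 2 <= 2 ^ (m + s + 2)).
  { rewrite !Nat.pow_add_r; pose proof (Nat.pow_gt_lin_r 2 s ltac:(lia)).
    simpl (2 ^ 2); nia. }
  apply (Nat.pow_le_mono_l _ _ (2 ^ e)) in Hbase.
  rewrite <- Nat.pow_mul_r in Hbase.
  assert (Hexp : 2 ^ 2 ^ S m <= (m + s + 2) * 2 ^ e).
  { apply (Nat.pow_le_mono_r_iff 2); lia. }
  assert (Hlt : (m + s + 2) * 2 ^ e < 2 ^ (m + s + 2 + e)).
  { rewrite Nat.pow_add_r; apply Nat.mul_lt_mono_pos_r.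
    - pose proof (Nat.pow_nonzero 2 e); lia.
    - apply Nat.pow_gt_lin_r; lia. }
  assert (2 ^ (m + s + 2 + e) <= 2 ^ 2 ^ S m) by (apply Nat.pow_le_mono_r; lia).
  lia.
Qed.

Theorem theorem1 :
  (forall f : nat -> nat, ARAM_poly f -> ASRAM_poly f) /\
  (exists f : nat -> nat, ASRAM_poly f /\ ~ ARAM_poly f).
Proof.
  split; [exact ARAM_poly_ASRAM_poly|].
  exists tower; split; [exact ASRAM_poly_tower|exact not_ARAM_poly_tower].
Qed.
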